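(* Let $n\ge2$, let $P$ be a positive regular polynomial $n$-tuple, let $m\in\mathbb N^n$, and let $\mathscr M_z=(\mathscr M_{z_1},\ldots,\mathscr M_{z_n})$ be the multiplication $n$-tuple on $\mathscr H^2_m(\triangle^n_P)$. Then: (i) the commutant $\{\mathscr M_z\}'$ is a maximal abelian subalgebra of $\mathcal B(\mathscr H^2_m(\triangle^n_P))$; (ii) $\{\mathscr M_z\}'$ is equal to the multiplier algebra of $\mathscr H^2_m(\triangle^n_P)$; (iii) $\{\mathscr M_z\}'$ is contractively contained in $\mathscr H^\infty(\triangle^n_P)$.
   Context: $\mathbb N$ = positive integers, $\mathbb C_*=\mathbb C\setminus\{0\}$, $z\diamond w=(z_1w_1,\ldots,z_nw_n)$ for $z,w\in\mathbb C^n$, and $\overline z$ is the entrywise conjugate. For $n\ge2$ let $\varphi(z)=\big(\frac{z_1}{z_2},\ldots,\frac{z_{n-1}}{z_n},z_n\big)$ for $z\in\mathbb C\times\mathbb C_*^{n-1}$. A polynomial $n$-tuple $P=(P_1,\ldots,P_n)$ in $\mathbb C[z_1,\ldots,z_n]$ is positive regular if for each $j$, $P_j$ has nonnegative coefficients and $P_j(z)=a_jz_j+\sum_{k=2}^{N_j}Q_{jk}(z)$ with $a_j>0$ and $Q_{jk}$ homogeneous of degree $k$. The $P$-triangle is the bounded domain $\triangle^n_P=\{z\in\mathbb C\times\mathbb C_*^{n-1}: P_j(\varphi(z)\diamond\overline{\varphi(z)})<1,\ j=1,\ldots,n\}$. For $m=(m_1,\ldots,m_n)\in\mathbb N^n$,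 $\mathscr H^2_m(\triangle^n_P)$ is the reproducing kernel Hilbert space of holomorphic functions on $\triangle^n_P$ with the positive semi-definite kernel $$\mathscr K_{P,m}(z,w)=\prod_{j=2}^n\frac1{z_j\overline w_j}\prod_{j=1}^n\frac1{\big(1-P_j(\varphi(z)\diamond\overline{\varphi(w)})\big)^{m_j}},\qquad z,w\in\triangle^n_P.$$ Each coordinate function $z_j$ is a multiplier of this space, and $\mathscr M_{z_j}$ is the bounded operator of multiplication by $z_j$. The commutant $\{\mathscr M_z\}'$ is the set of all bounded operators on the space commuting with $\mathscr M_{z_1},\ldots,\mathscr M_{z_n}$. The multiplier algebra is $\{\mathscr M_\phi:\phi\text{ is a multiplier}\}$ with the operator norm, where $\phi:\triangle^n_P\to\mathbb C$ is a multiplier if $\phi f\in\mathscr H^2_m(\triangle^n_P)$ for all $f\in \mathscr H^2_m(\triangle^n_P)$, and $\mathscr M_\phi f=\phi f$. $\mathscr H^\infty(\triangle^n_P)$ is the Banach algebra of bounded holomorphic functions on $\triangle^n_P$ with the sup norm. Contractive containment in (iii) is under the identification $\mathscr M_\phi\leftrightarrow\phi$: each such $\phi$ lies in $\mathscr H^\infty(\triangle^n_P)$ and $\|\phi\|_\infty\le\|\mathscr M_\phi\|$. *)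

(* Defs.v *)
From HB Require Import structures.
From mathcomp Require Import all_boot all_order all_algebra.
(* Only the structures on mpoly: its notations clash with those of
   MathComp-Analysis. *)
From mathcomp Require mpoly.
Import (canonicals, coercions) mpoly.
From mathcomp Require Import all_classical all_reals all_analysis.
From mathcomp.real_closed Require Import complex.

Set Implicit Arguments.
Unset Strict Implicit.
Unset Printing Implicit Defensive.

Import Order.TTheory GRing.Theory Num.Theory.
Import numFieldNormedType.Exports.

Local Open Scope classical_set_scope.
Local Open Scope ring_scope.
Local Open Scope complex_scope.

(* The norm topology of R[i], as a normed space over itself, so that
   [differentiable] between R[i]-normed spaces is complex differentiability. *)
HB.instance Definition _ (R : realType) := NormedModule.copy R[i] R[i]^o.

Section Triangle.
Variables (R : realType) (n : nat).
Local Notation C := R[i].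
Implicit Types (z w : 'rV[C]_n).

Definition diamond z w : 'rV[C]_n := \row_j (z 0 j * w 0 j).

Definition conj_rV z : 'rV[C]_n := map_mx Num.conj z.

(* z |-> (z_1/z_2, ..., z_(n-1)/z_n, z_n); indices are shifted by one, and
   [ordS j] is the index following [j] when [j] is not the last one. *)
Definition phi z : 'rV[C]_n :=
  \row_j (if (j.+1 < n)%N then z 0 j / z 0 (ordS j) else z 0 j).

Definition evalp (p : mpoly.mpoly n C) z : C := mpoly.meval (fun j => z 0 j) p.

(* In the order of R[i], [0 <= c] means that c is real and nonnegative. *)
Definition positive_regular (P : 'I_n -> mpoly.mpoly n C) : Prop :=
  forall j,
    (forall u, 0 <= mpoly.mcoeff u (P j)) /\
    exists (a : C) (N : nat) (Q : nat -> mpoly.mpoly n C),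
      [/\ 0 < a,
          forall k, (2 <= k <= N)%N ->
            Q k \is mpoly.ishomog1 k (@mpoly.mdeg n)
        & P j = a *: mpoly.mpolyX C (mpoly.mnm1 j)
                + \sum_(2 <= k < N.+1) Q k].

Variables (P : 'I_n -> mpoly.mpoly n C) (m : 'I_n -> nat).

Definition triangle : set 'rV[C]_n :=
  [set z : 'rV[C]_n | (forall j : 'I_n, (0 < j)%N -> z 0 j != 0) /\
           (forall j, evalp (P j) (diamond (phi z) (conj_rV (phi z))) < 1)].

Definition kernelPm z w : C :=
  (\prod_(j < n | (0 < j)%N) (z 0 j * Num.conj (w 0 j))^-1) *
  \prod_(j < n)
    ((1 - evalp (P j) (diamond (phi z) (conj_rV (phi w)))) ^+ m j)^-1.

Definition triangle_kernel (z w : triangle) : C :=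
  kernelPm (set_val z) (set_val w).

End Triangle.

(* Fréchet complex differentiability at every point of D. The values of the
   extension F outside D are irrelevant when D is open. *)
Definition holomorphic (R : realType) (n : nat) (D : set 'rV[R[i]]_n)
    (f : D -> R[i]) : Prop :=
  exists F : 'rV[R[i]]_n -> R[i],
    (forall z : D, F (set_val z) = f z) /\
    (forall z : 'rV[R[i]]_n, D z -> differentiable F z).

(* A Hilbert space of functions on X with reproducing kernel k. Its elements
   are identified with functions on X through the injective linear map [ev].
   Such a space is unique up to an isometry compatible with [ev]. *)
Record rkhs (R : realType) (X : Type) (k : X -> X -> R[i]) := Rkhs {
  rkhs_space :> completeNormedModType R[i];
  inner : {dot rkhs_space for Num.conj};
  inner_norm : forall f, inner f f = `|f| ^+ 2;
  ev : rkhs_space -> X -> R[i];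
  ev_linear : forall (a : R[i]) f g x, ev (a *: f + g) x = a * ev f x + ev g x;
  ev_inj : injective ev;
  kvec : X -> rkhs_space;
  kvecE : forall z w, ev (kvec w) z = k z w;
  reproducing : forall f w, ev f w = inner f (kvec w)
}.

Record H2m (R : realType) (n : nat) (P : 'I_n -> mpoly.mpoly n R[i])
    (m : 'I_n -> nat) := MkH2m {
  H2m_rkhs :> rkhs (@triangle_kernel R n P m);
  H2m_holomorphic : forall f : H2m_rkhs, holomorphic (ev f)
}.

Section Operators.
Variables (R : realType) (V : completeNormedModType R[i]).

Definition bounded_op (T : V -> V) : Prop :=
  linear T /\ exists M : R, forall f, `|T f| <= M%:C * `|f|.

(* Norms are R[i]-valued (and real), hence the real part. *)
Definition opnorm (T : V -> V) : R :=
  sup [set complex.Re `|T f| | f in [set f : V | `|f| <= 1]].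

Definition subalgebra (A : set (V -> V)) : Prop :=
  [/\ A `<=` bounded_op,
      A (fun=> 0),
      forall (a : R[i]) S T, A S -> A T -> A (fun f => a *: S f + T f)
    & forall S T, A S -> A T -> A (S \o T)].

Definition abelian_ops (A : set (V -> V)) : Prop :=
  forall S T, A S -> A T -> S \o T = T \o S.

Definition maximal_abelian_subalgebra (A : set (V -> V)) : Prop :=
  [/\ subalgebra A, abelian_ops A
    & forall B, subalgebra B -> abelian_ops B -> A `<=` B -> B = A].

Definition commutant (I : Type) (M : I -> V -> V) : set (V -> V) :=
  [set T | bounded_op T /\ forall i, T \o M i = M i \o T].

End Operators.

Section Multipliers.
Variables (R : realType) (X : Type) (k : X -> X -> R[i]) (H : rkhs k).

Definition multiplier (u : X -> R[i]) : Prop :=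
  forall f : H, exists g : H, ev g = (fun x => u x * ev f x).

(* The element of H representing u f, unique since [ev] is injective; the
   default 0 is only reached when u is not a multiplier. *)
Definition mult_op (u : X -> R[i]) (f : H) : H :=
  xget 0 [set g : H | ev g = (fun x => u x * ev f x)].

Definition multiplier_algebra : set (H -> H) :=
  [set mult_op u | u in multiplier].

End Multipliers.

Arguments multiplier {R X k} H u.
Arguments mult_op {R X k} H u f.
Arguments multiplier_algebra {R X k} H.

Section Hinfty.
Variables (R : realType) (n : nat) (D : set 'rV[R[i]]_n).

Definition Hinfty (f : D -> R[i]) : Prop :=
  holomorphic f /\ exists M : R, forall z, `|f z| <= M%:C.

Definition supnorm (f : D -> R[i]) : R := sup (range (fun z => complex.Re `|f z|)).

End Hinfty.

Definition coord_fun (R : realType) (n : nat) (D : set 'rV[R[i]]_n)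
    (j : 'I_n) : D -> R[i] := fun z => set_val z 0 j.

Definition commutant_Mz (R : realType) (n : nat)
    (P : 'I_n -> mpoly.mpoly n R[i]) (m : 'I_n -> nat) (H : H2m P m) :
    set (H -> H) :=
  commutant (fun j : 'I_n => mult_op H (@coord_fun R n _ j)).

Arguments commutant_Mz {R n P m} H _.

(* Main.v *)
Require Import Defs.
From mathcomp Require Import all_boot all_order all_algebra.
From mathcomp Require Import ring.
From mathcomp Require Import lra.
From mathcomp Require Import all_classical all_reals all_analysis.
From mathcomp.real_closed Require Import complex.
From mathcomp Require mpoly.
Import (canonicals, coercions) mpoly.
Import Order.TTheory GRing.Theory Num.Theory.
Import numFieldNormedType.Exports.
Set Implicit Arguments.
Unset Strict Implicit.
Unset Printing Implicit Defensive.
Local Open Scope classical_set_scope.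
Local Open Scope ring_scope.
Local Open Scope complex_scope.

(* Write [zeta = phi z], [omega = phi w], [p_j = P_j (zeta <> conj omega)], and
   let [J] be the product of the [1/z_j], [j >= 2]. The operator of
   multiplication by [zeta_i] is bounded: since [p_i - a_i zeta_i conj omega_i]
   has nonnegative coefficients, [(1/a_i - zeta_i conj omega_i) / (1 - p_i)] is
   a positive kernel, hence so is [(1/a_i - zeta_i conj omega_i) K].
   An operator [T] in the commutant commutes with multiplication by [zeta_i],
   because [z_(i+1) zeta_i = z_i] and [z_(i+1)] has no zero. It therefore
   commutes with multiplication by the polynomial
   [q_w = prod_j (1 - p_j)^(m_j)] in [zeta]. As [q_w K(., w) = conj (J w) J],
   the quotient [T K(., w) / K(., w)] does not depend on [w], and [T] is
   multiplication by it. That all multipliers act boundedly is the closed graph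
   theorem, obtained here from uniform boundedness and the Riesz
   representation theorem; the sup norm bound is
   [<T k_w, k_w> = f(w) K(w, w)]. *)

(** * Norms and inner products with real values *)

Section RealNorm.
Variables (R : realType) (V : normedModType R[i]).
Implicit Types (u v : V) (e : R).

(** Norms here take values in [R[i]]; a copy in [R] gives access to infima and to [lra] and
    [nra]. *)
Definition rnorm u : R := complex.Re `|u|.

Lemma rnormE u : `|u| = (rnorm u)%:C.
Proof. by rewrite RRe_real ?normr_real. Qed.

Lemma rnorm_ge0 u : 0 <= rnorm u.
Proof. by rewrite -ler0c -rnormE. Qed.

Lemma rnorm0 : rnorm 0 = 0.
Proof. by rewrite /rnorm normr0. Qed.

Lemma rnorm_eq0 u : (rnorm u == 0) = (u == 0).
Proof. by rewrite -[RHS]normr_eq0 rnormE -(inj_eq (@complexI R)). Qed.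

Lemma rnormB u v : rnorm (u - v) = rnorm (v - u).
Proof. by rewrite /rnorm distrC. Qed.

Lemma rnormD u v : rnorm (u + v) <= rnorm u + rnorm v.
Proof. by rewrite -lecR rmorphD/= -!rnormE ler_normD. Qed.

Lemma rnormZ (a : R[i]) u : rnorm (a *: u) = complex.Re `|a| * rnorm u.
Proof.
by apply: complexI; rewrite rmorphM/= -!rnormE normrZ.
Qed.

Lemma rnormZr e u : rnorm (e%:C *: u) = `|e| * rnorm u.
Proof. by rewrite rnormZ normc_def /= expr0n addr0 sqrtr_sqr. Qed.

End RealNorm.

Lemma rnorm_complete (R : realType) (V : completeNormedModType R[i])
    (u : nat -> V) :
  (forall e : R, 0 < e -> exists N, forall n m, (N <= n)%N -> (N <= m)%N ->
     rnorm (u n - u m) < e) ->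
  exists g, forall e : R, 0 < e -> exists N, forall n, (N <= n)%N ->
     rnorm (u n - g) < e.
Proof.
move=> cu.
have cv : cvg (u @ \oo).
  apply: cauchy_cvg; apply: cauchy_exP => /= e e0.
  have e1 : e = (complex.Re e)%:C by rewrite RRe_real ?gtr0_real.
  rewrite e1 in e0 *.
  have [|N HN] := cu (complex.Re e); first by rewrite -ltcR.
  exists (u N), N => // n /= Nn.
  by rewrite -ball_normE /= rnormE ltcR HN.
exists (lim (u @ \oo)) => e e0.
move/cvgrPdist_lt : (cv : u @ \oo --> lim (u @ \oo)) => /(_ e%:C).
rewrite ltcR => /(_ e0) [N _ HN]; exists N => n Nn.
by rewrite rnormB -ltcR -rnormE; apply: HN.
Qed.

Section Hilbert.
Variables (R : realType) (V : completeNormedModType R[i]).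
Variable dot : {dot V for Num.conj}.
Hypothesis dotE : forall u, dot u u = `|u| ^+ 2.
Implicit Types (u v w : V) (a c : R[i]).

Lemma dotDl u v w : dot (u + v) w = dot u w + dot v w.
Proof. exact: linearDl. Qed.

Lemma dotDr u v w : dot w (u + v) = dot w u + dot w v.
Proof. exact: linearDr. Qed.

Lemma dotZl a u w : dot (a *: u) w = a * dot u w.
Proof. exact: linearZl_LR. Qed.

Lemma dotZr a u w : dot w (a *: u) = Num.conj a * dot w u.
Proof. by rewrite linearZr_LR. Qed.

Lemma dotNl u w : dot (- u) w = - dot u w.
Proof. by rewrite -scaleN1r dotZl mulN1r. Qed.

Lemma dotNr u w : dot w (- u) = - dot w u.
Proof. by rewrite -scaleN1r dotZr rmorphN1 mulN1r. Qed.

Lemma dotC u v : dot u v = Num.conj (dot v u).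
Proof. by rewrite (hermC dot) expr0 mul1r. Qed.

Lemma dot_suml (I : Type) (s : seq I) (f : I -> V) w :
  dot (\sum_(i <- s) f i) w = \sum_(i <- s) dot (f i) w.
Proof.
elim/big_ind2 : _ => [|x1 x2 y1 y2 <- <-|//]; last by rewrite dotDl.
by rewrite -(scale0r 0) dotZl mul0r.
Qed.

Lemma dot_ge0 u : 0 <= dot u u.
Proof. by rewrite dotE exprn_ge0. Qed.

Lemma cauchy_schwarz u v : `|dot u v| <= `|u| * `|v|.
Proof.
have [->|v0] := eqVneq v 0.
  by rewrite -[X in dot u X](scale0r 0) dotZr rmorph0 mul0r normr0 mulr_ge0.
have vv0 : 0 < dot v v by rewrite dotE exprn_gt0 ?normr_gt0.
rewrite -(@ler_pXn2r _ 2) ?nnegrE ?mulr_ge0// exprMn -!dotE normCK.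
(* This is [dot v v] times the component of [u] orthogonal to [v], scaled so that no division
   occurs. *)
set w := dot v v *: u - dot u v *: v.
have ww : dot w w = dot v v * (dot v v * dot u u - dot u v * Num.conj (dot u v)).
  rewrite /w !(dotDl, dotDr, dotNl, dotNr, dotZl, dotZr) -dotC.
  by rewrite (dotC v u); ring.
have := dot_ge0 w.
by rewrite ww pmulr_rge0// subr_ge0 [X in _ <= X]mulrC.
Qed.

Lemma Re_dot_le u v : `|complex.Re (dot u v)| <= rnorm u * rnorm v.
Proof.
rewrite -lecR rmorphM/= -!rnormE.
exact: le_trans (normc_ge_Re _) (cauchy_schwarz _ _).
Qed.

Lemma Re_dotC u v : complex.Re (dot u v) = complex.Re (dot v u).
Proof. by rewrite dotC; case: (dot v u). Qed.

Lemma rnorm_sqr u : rnorm u ^+ 2 = complex.Re (dot u u).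
Proof. by rewrite dotE rnormE -rmorphXn. Qed.

Lemma rnorm_sqrD u v :
  rnorm (u + v) ^+ 2 = rnorm u ^+ 2 + rnorm v ^+ 2 + 2 * complex.Re (dot u v).
Proof.
rewrite !rnorm_sqr !(dotDl, dotDr) !raddfD/= [complex.Re (dot v u)]Re_dotC.
ring.
Qed.

Lemma parallelogram u v :
  rnorm (u + v) ^+ 2 + rnorm (u - v) ^+ 2 =
  2 * (rnorm u ^+ 2 + rnorm v ^+ 2).
Proof.
rewrite !rnorm_sqr !(dotDl, dotDr, dotNl, dotNr) !(raddfD, raddfN)/= !raddfN/=.
by ring.
Qed.

End Hilbert.

(** * Riesz representation *)

Section Riesz.
Variables (R : realType) (V : completeNormedModType R[i]).
Variable dot : {dot V for Num.conj}.
Hypothesis dotE : forall u, dot u u = `|u| ^+ 2.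
Implicit Types (u v w : V) (a c d : R[i]).

Lemma Re_mulr (t : R) c : complex.Re (t%:C * c) = t * complex.Re c.
Proof. by case: c => x y /=; rewrite mul0r subr0. Qed.

Lemma eq_Re_mul (x y : R[i]) :
  complex.Re x = complex.Re y -> complex.Re ('i * x) = complex.Re ('i * y) ->
  x = y.
Proof.
case: x y => [x1 x2] [y1 y2] /= -> /eqP.
by rewrite !mul0r !sub0r !mul1r eqr_opp => /eqP ->.
Qed.

(* The representing vector is the limit of a minimising sequence of
   [|v|^2 - 2 Re c] on the graph. *)
Lemma riesz_graph (G : V -> R[i] -> Prop) (M : R) :
  0 <= M -> G 0 0 ->
  (forall a v c w d, G v c -> G w d -> G (a *: v + w) (a * c + d)) ->
  (forall v c, G v c -> `|c| <= M%:C * `|v|) ->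
  exists g, (forall v c, G v c -> dot v g = c) /\ rnorm g <= M.
Proof.
move=> M0 G0 Glin GM.
have GZ a v c : G v c -> G (a *: v) (a * c).
  by move=> Gv; have := Glin a _ _ _ _ Gv G0; rewrite !addr0.
have GD v c w d : G v c -> G w d -> G (v + w) (c + d).
  by move=> Gv; have := Glin 1 _ _ w d Gv; rewrite scale1r mul1r.
pose J v c : R := rnorm v ^+ 2 - 2 * complex.Re c.
pose E := [set x | exists v c, G v c /\ x = J v c].
have lbE : lbound E (- M ^+ 2).
  move=> _ [v [c [Gv ->]]].
  have : complex.Re c <= M * rnorm v.
    rewrite -lecR rmorphM/= -rnormE; apply: le_trans (GM _ _ Gv).
    by apply: le_trans (normc_ge_Re c); rewrite lecR ler_norm.
  have := sqr_ge0 (rnorm v - M); rewrite /J; nra.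
have hE : has_inf E by split; [exists (J 0 0), 0, 0|exists (- M ^+ 2)].
pose mu := inf E.
have mu_le v c : G v c -> mu <= J v c.
  by move=> Gv; apply: ge_inf; [case: hE|exists v, c].
have /choice[s sP] (n : nat) : exists p : V * R[i],
    G p.1 p.2 /\ J p.1 p.2 < mu + n.+1%:R^-1.
  have [|x [v [c [Gv ->]]] xlt] := @inf_adherent _ E n.+1%:R^-1 _ hE => //.
  by exists (v, c).
(* Parallelogram law: the midpoint of two near-minimisers stays on the graph, where [J] is at least
   [mu]. *)
have dist v c w d (e : R) : G v c -> G w d -> J v c < mu + e ->
    J w d < mu + e -> rnorm (v - w) ^+ 2 <= 4 * e.
  move=> Gv Gw Jv Jw.
  have := mu_le _ _ (GZ (2^-1)%:C _ _ (GD _ _ _ _ Gv Gw)).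
  have := parallelogram dotE v w.
  rewrite /J rnormZr ger0_norm ?invr_ge0 ?ler0n// Re_mulr raddfD/= exprMn.
  move: Jv Jw; rewrite /J; lra.
have [|g gP] := @rnorm_complete _ _ (fun n => (s n).1).
  move=> e e0; exists (Num.truncn (4 / e ^+ 2)) => n m Nn Nm.
  set N := Num.truncn _ in Nn Nm.
  have Ne : 4 * N.+1%:R^-1 < e ^+ 2.
    by rewrite ltr_pdivrMr// mulrC -ltr_pdivrMr ?exprn_gt0// truncnS_gt.
  rewrite -(@ltr_pXn2r _ 2) ?nnegrE ?rnorm_ge0 ?ltW//.
  apply: le_lt_trans Ne.
  have le_inv k : (N <= k)%N -> k.+1%:R^-1 <= N.+1%:R^-1 :> R.
    by move=> Nk; rewrite lef_pV2 ?posrE// ler_nat.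
  have [Gn Jn] := sP n; have [Gm Jm] := sP m.
  by apply: dist Gn Gm _ _; rewrite (lt_le_trans Jn, lt_le_trans Jm)// lerD2l le_inv.
have approx (e : R) : 0 < e -> exists v c,
    [/\ G v c, J v c < mu + e & rnorm (v - g) < e].
  move=> e0; have [N NP] := gP e e0.
  pose n := maxn N (Num.truncn e^-1).
  have [Gn Jn] := sP n; exists (s n).1, (s n).2; split => //.
    apply: lt_le_trans Jn _; rewrite lerD2l invf_ple ?posrE//.
    apply: ltW; apply: lt_le_trans (truncnS_gt _) _.
    by rewrite ler_nat ltnS leq_maxr.
  by apply: NP; rewrite leq_maxl.
have Re_eq h d : G h d -> complex.Re (dot g h) = complex.Re d.
  move=> Gh; set x := complex.Re (dot g h) - complex.Re d.
  (* First variation of [J] at [g] in the direction [h]. Since [g] may lie off the domain of the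
     graph, a nearby [v] on it stands in for [g]. *)
  have quad (t : R) : 0 <= 2 * t * x + t ^+ 2 * rnorm h ^+ 2.
    rewrite leNgt; apply/negP => lt0.
    set y := _ + _ in lt0.
    (* With precision [e], replacing [g] by [v] costs at most [e] in [J] and 2 |t| e |h| in the
       cross term, in total [k * e]; taking [e = - y / k] turns this into [- y]. *)
    pose k := 1 + 2 * `|t| * rnorm h.
    have k0 : 0 < k by rewrite /k ltr_pwDl// !mulr_ge0 ?rnorm_ge0.
    have [|v [c [Gv Jv vg]]] := approx (- y / k).
      by rewrite divr_gt0 ?oppr_gt0.
    set e := - y / k in Jv vg.
    have ke : k * e = - y by rewrite mulrC divfK ?gt_eqF.
    have := mu_le _ _ (Glin t%:C _ _ _ _ Gh Gv).
    rewrite /J addrC [t%:C * d + c]addrC (rnorm_sqrD dotE) rnormZr raddfD/= Re_mulr.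
    rewrite dotZl Re_mulr (Re_dotC dot h v) exprMn real_normK ?num_real//.
    have := Re_dot_le dotE (v - g) h.
    rewrite dotDl dotNl raddfD raddfN/=.
    set p := complex.Re (dot v h) => pg.
    have : `|t * (p - complex.Re (dot g h))| <= `|t| * (e * rnorm h).
      rewrite normrM ler_wpM2l//; apply: le_trans pg _.
      by rewrite ler_wpM2r ?rnorm_ge0// ltW.
    rewrite ler_norml => /andP[_ tpg].
    move: Jv ke; rewrite /J /k /y /x; nra.
  have H0 : 0 <= rnorm h ^+ 2 by rewrite exprn_ge0 ?rnorm_ge0.
  set H := rnorm h ^+ 2 in quad H0.
  have H1 : 0 < H + 1 by rewrite ltr_wpDl.
  (* The minimum is at [- x / H]; the denominator [H + 1] is never zero and still forces [x = 0]. *)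
  have := quad (- x / (H + 1)).
  have -> : 2 * (- x / (H + 1)) * x + (- x / (H + 1)) ^+ 2 * H =
     - (x ^+ 2 * (H + 2) / (H + 1) ^+ 2) by field; rewrite gt_eqF.
  rewrite oppr_ge0 pmulr_lle0 ?invr_gt0 ?exprn_gt0// pmulr_lle0; last by lra.
  move=> x2; have : x ^+ 2 == 0 by rewrite eq_le x2 sqr_ge0.
  by rewrite expf_eq0/= /x subr_eq0 => /eqP.
have main v c : G v c -> dot v g = c.
  move=> Gv; apply: eq_Re_mul; first by rewrite Re_dotC (Re_eq _ _ Gv).
  by rewrite -dotZl Re_dotC; apply: Re_eq; apply: GZ.
exists g; split=> //.
have [/eqP|g0] := eqVneq (rnorm g) 0.
  by rewrite rnorm_eq0 => /eqP ->; rewrite rnorm0.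
have gg0 : 0 < rnorm g by rewrite lt_def g0 rnorm_ge0.
apply/ler_addgt0Pr => e e0.
(* Chosen so that |g|^2 <= Re <v, g> + r |g| <= M (|g| + r) + r |g| = |g| (M + e). *)
pose r := rnorm g * e / (M + rnorm g).
have Mg : 0 < M + rnorm g by rewrite ltr_wpDl.
have [|v [c [Gv _ vg]]] := approx r; first by rewrite divr_gt0 ?mulr_gt0.
have rE : r * (M + rnorm g) = rnorm g * e by rewrite divfK ?gt_eqF.
have h1 : complex.Re (dot v g) <= M * rnorm v.
  rewrite (main _ _ Gv) -lecR rmorphM/= -rnormE; apply: le_trans (GM _ _ Gv).
  by apply: le_trans (normc_ge_Re c); rewrite lecR ler_norm.
have := Re_dot_le dotE (v - g) g.
rewrite dotDl dotNl raddfD raddfN/= -rnorm_sqr// ler_norml => /andP[h2 _].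
have h3 : rnorm v <= rnorm g + r.
  have := rnormD (v - g) g; rewrite subrK => /le_trans; apply.
  by rewrite addrC lerD2l ltW.
rewrite -(ler_pM2l gg0); nra.
Qed.

End Riesz.

(** * Uniform boundedness *)


Section UniformBoundedness.
Variables (R : realType) (V : completeNormedModType R[i]).
Variables (I : Type) (p : I -> V -> R).
Hypothesis pD : forall i u v, p i (u + v) <= p i u + p i v.
Hypothesis pZ : forall i (r : R) u, p i (r%:C *: u) = `|r| * p i u.
Hypothesis p_bounded : forall i, exists M, forall u, p i u <= M * rnorm u.

(** Nested balls: if no uniform bound exists, each ball contains a smaller one on which some [p i]
    is as large as desired. The limit of the centres lies in all of them and contradicts the
    pointwise bound. *)
Lemma uniform_boundedness :
  (forall u, exists M, forall i, p i u <= M) ->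
  exists M, forall i u, p i u <= M * rnorm u.
Proof.
move=> pw; apply: contrapT => unb.
have pN i u : p i (- u) = p i u.
  by rewrite -scaleN1r -[-1](rmorphN1 (real_complex R)) pZ normrN1 mul1r.
(* A ball is a pair of centre and radius. The positivity premise sits under the existential so that
   [choice] yields a total map. *)
have step (a : nat * (V * R)) : exists b : V * R, 0 < a.2.2 ->
    [/\ 0 < b.2, b.2 <= a.2.2 / 2, rnorm (b.1 - a.2.1) <= a.2.2 / 2 &
        exists i, forall y, rnorm (y - b.1) <= b.2 -> a.1%:R <= p i y].
  case: a => n [x r] /=; have [r0|r0] := ltP 0 r; last by exists (x, r).
  have [i [u pu]] : exists i u, n.+1%:R / (r / 2) * rnorm u < p i u.
    apply: contrapT => nex; apply: unb; exists (n.+1%:R / (r / 2)) => i u.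
    by rewrite leNgt; apply/negP => ?; apply: nex; exists i, u.
  have u0 : 0 < rnorm u.
    rewrite lt_def rnorm_ge0 andbT rnorm_eq0; apply/negP => /eqP u0.
    move: pu; rewrite u0 rnorm0 mulr0.
    by have := pZ i 0 0; rewrite scaler0 normr0 mul0r => ->; rewrite ltxx.
  have r20 : 0 < r / 2 by rewrite divr_gt0.
  set h := (r / 2 / rnorm u)%:C *: u.
  have hr : rnorm h = r / 2.
    by rewrite rnormZr gtr0_norm ?divr_gt0// divfK ?gt_eqF.
  have ph : n.+1%:R <= p i h.
    rewrite pZ gtr0_norm ?divr_gt0// mulrAC ler_pdivlMr// -ler_pdivrMl//.
    by rewrite mulrA [_^-1 * _]mulrC ltW.
  (* As [x + h] and [x - h] differ by twice [h], one of them has a value of at least [n.+1]; the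
     unit above [n] is spent on the points near [x']. *)
  have [x' [px' x'x]] : exists x', n.+1%:R <= p i x' /\ rnorm (x' - x) = r / 2.
    have := pD i (x + h) (- (x - h)).
    have -> : x + h + - (x - h) = (2 : R)%:C *: h.
      by rewrite rmorph_nat scaler_nat mulr2n opprB [h - x]addrC addrACA subrr add0r.
    rewrite pN pZ ger0_norm// => le2.
    have [px|px] := leP n.+1%:R (p i (x + h)).
      by exists (x + h); rewrite [x + h - x]addrAC subrr add0r hr.
    exists (x - h); rewrite [x - h - x]addrAC subrr add0r -hr /rnorm normrN; split=> //.
    lra.
  have [C CP] := p_bounded i.
  have C1 : 0 < `|C| + 1 by rewrite ltr_wpDl.
  (* The second radius keeps the variation of [p i] on the ball below 1. *)
  exists (x', Num.min (r / 2) (`|C| + 1)^-1); split=> //=.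
  - by rewrite lt_min r20 invr_gt0 C1.
  - by rewrite ge_min lexx.
  - by rewrite x'x.
  exists i => y; rewrite le_min => /andP[_ yx'].
  have := pD i y (- (y - x')); rewrite opprB addrC subrK addrC.
  have := CP (x' - y); rewrite rnormB.
  have : C * rnorm (y - x') <= 1.
    have : `|C| * rnorm (y - x') <= `|C| * (`|C| + 1)^-1 by rewrite ler_wpM2l.
    have : `|C| * (`|C| + 1)^-1 <= 1 by rewrite ler_pdivrMr// mul1r lerDl.
    have := ler_norm C; have := rnorm_ge0 (y - x'); nra.
  by move: px'; rewrite -natr1 addrC; lra.
have [f fP] := choice step.
pose fix s n := if n is n'.+1 then f (n', s n') else (0 : V, 1 : R).
have s0 n : 0 < (s n).2.
  by elim: n => [|n IH] //=; have [] := fP (n, s n) IH.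
(* Halving the radius beats the factor [n.+2 / n.+1], so the radii tend to 0. *)
have sinv n : (s n).2 * n.+1%:R <= 1.
  elim: n => [|n IH]; first by rewrite mulr1.
  have [_ /= h _ _] := fP (n, s n) (s0 n).
  apply: le_trans (IH); apply: le_trans (_ : (s n).2 / 2 * n.+2%:R <= _).
    by rewrite ler_wpM2r.
  rewrite -mulrA ler_pM2l// ler_pdivrMl// -natrM ler_nat.
  by rewrite mul2n -addnn !addnS ltnS leq_addr.
have nested n k : rnorm ((s (n + k)%N).1 - (s n).1) + (s (n + k)%N).2 <= (s n).2.
  elim: k => [|k IH]; first by rewrite addn0 subrr rnorm0 add0r.
  rewrite addnS; have [_ /= h1 h2 _] := fP ((n + k)%N, s (n + k)%N) (s0 _).
  have := rnormD ((s (n + k).+1).1 - (s (n + k)%N).1) ((s (n + k)%N).1 - (s n).1).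
  by rewrite addrA subrK /=; move: h1 h2 IH; lra.
have nestedW n m : (n <= m)%N -> rnorm ((s m).1 - (s n).1) <= (s n).2.
  by move=> nm; have := nested n (m - n)%N; rewrite subnKC//; have := s0 m; lra.
have [|g gP] := @rnorm_complete _ _ (fun n => (s n).1).
  move=> e e0; exists (Num.truncn (2 / e)) => n m Nn Nm.
  set N := Num.truncn _ in Nn Nm.
  have : 2 < e * N.+1%:R.
    by rewrite mulrC -ltr_pdivrMr// truncnS_gt.
  have := rnormD ((s n).1 - (s N).1) ((s N).1 - (s m).1).
  rewrite addrA subrK [rnorm ((s N).1 - _)]rnormB.
  have := nestedW _ _ Nn; have := nestedW _ _ Nm; have := sinv N.
  have : 0 < N.+1%:R :> R by [].
  nra.
have gs n : rnorm (g - (s n).1) <= (s n).2.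
  apply/ler_addgt0Pr => e e0; have [N NP] := gP e e0.
  have := NP (maxn N n) (leq_maxl _ _); have := nestedW _ _ (leq_maxr N n).
  have := rnormD (g - (s (maxn N n)).1) ((s (maxn N n)).1 - (s n).1).
  rewrite addrA subrK [rnorm (g - (s (maxn N n)).1)]rnormB; lra.
have [M MP] := pw g.
(* Ball number [(Num.truncn M).+2] was built with lower bound [(Num.truncn M).+1], which exceeds
   [M]. *)
have [_ _ _ [i /(_ g (gs (Num.truncn M).+2))]] :=
  fP ((Num.truncn M).+1, s (Num.truncn M).+1) (s0 _).
apply/negP; rewrite -ltNge /=; apply: le_lt_trans (MP i) _.
exact: truncnS_gt.
Qed.

End UniformBoundedness.

(** * Multipliers of a reproducing kernel space *)


Section ReproducingKernel.
Variables (R : realType) (X : Type) (k : X -> X -> R[i]) (H : rkhs k).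
Implicit Types (f g : H) (u : X -> R[i]) (s : seq (R[i] * X)).

Let dotE : forall f, inner H f f = `|f| ^+ 2 := @inner_norm _ _ _ H.

Lemma evD f g x : ev (f + g) x = ev f x + ev g x.
Proof. by rewrite -[f]scale1r ev_linear mul1r scale1r. Qed.

Lemma ev0 x : ev (0 : H) x = 0.
Proof. by apply: (addrI (ev (0 : H) x)); rewrite -evD !addr0. Qed.

Lemma evZ a f x : ev (a *: f) x = a * ev f x.
Proof. by rewrite -[a *: f]addr0 ev_linear ev0 addr0. Qed.

Lemma evP f g : (forall x, ev f x = ev g x) -> f = g.
Proof. by move=> fg; apply: ev_inj; apply/funext. Qed.

Lemma inner_kvecl f w : inner H (kvec H w) f = Num.conj (ev f w).
Proof. by rewrite reproducing -dotC. Qed.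

Lemma inner_kvec z w : inner H (kvec H w) (kvec H z) = k z w.
Proof. by rewrite -reproducing kvecE. Qed.

Definition kcomb s : H := \sum_(p <- s) p.1 *: kvec H p.2.

Lemma kcomb_cat s t : kcomb (s ++ t) = kcomb s + kcomb t.
Proof. by rewrite /kcomb big_cat. Qed.

(** With [v] the conjugate of [u], this is the adjoint of multiplication by [u] on kernel
    combinations: each kernel vector is an eigenvector of it. *)
Definition kweight (v : X -> R[i]) s : seq (R[i] * X) :=
  [seq (v p.2 * p.1, p.2) | p <- s].

Lemma kweight_cat v s t : kweight v (s ++ t) = kweight v s ++ kweight v t.
Proof. exact: map_cat. Qed.

Lemma kweightC v w s : kweight v (kweight w s) = kweight w (kweight v s).
Proof.
by rewrite /kweight -!map_comp; apply: eq_map => p /=; rewrite mulrCA.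
Qed.

Lemma kcomb_scale a s : kcomb (kweight (fun=> a) s) = a *: kcomb s.
Proof.
rewrite /kcomb big_map scaler_sumr.
by apply: eq_bigr => p _; rewrite scalerA.
Qed.

Lemma kcomb_lin a s t :
  kcomb (kweight (fun=> a) s ++ t) = a *: kcomb s + kcomb t.
Proof. by rewrite kcomb_cat kcomb_scale. Qed.

Lemma kcomb1 w : kcomb [:: (1, w)] = kvec H w.
Proof. by rewrite /kcomb big_seq1 scale1r. Qed.

Lemma inner_kcomb f s :
  inner H (kcomb s) f = \sum_(p <- s) p.1 * Num.conj (ev f p.2).
Proof.
by rewrite dot_suml; apply: eq_bigr => p _; rewrite dotZl inner_kvecl.
Qed.

Lemma inner_kcomb2 s t :
  inner H (kcomb s) (kcomb t) =
  \sum_(p <- s) \sum_(q <- t) p.1 * Num.conj q.1 * k q.2 p.2.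
Proof.
rewrite dot_suml; apply: eq_bigr => p _.
rewrite dotZl dotC dot_suml rmorph_sum/= mulr_sumr; apply: eq_bigr => q _.
by rewrite dotZl inner_kvec rmorphM/= -inner_kvec -dotC inner_kvec mulrA.
Qed.

(** If the candidate adjoint is bounded on kernel combinations, pairing it with [f] is a bounded
    functional; its Riesz vector is the product of [u] and [f]. *)
Lemma multiplierP u (c : R) : 0 <= c ->
  (forall s, `|kcomb (kweight (Num.conj \o u) s)| <= c%:C * `|kcomb s|) ->
  multiplier H u.
Proof.
move=> c0 bnd f.
pose ku := kweight (Num.conj \o u).
(* A vector may be a kernel combination in several ways, so the functional is given as a relation;
   its bound makes it single-valued. *)
pose G v d := exists s, v = kcomb s /\ d = inner H (kcomb (ku s)) f.
have [||a v c1 w d [s [-> ->]] [t [-> ->]]|v d [s [-> ->]]|g [gG _]] :=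
    @riesz_graph _ _ (inner H) dotE G (c * rnorm f).
- by rewrite mulr_ge0 ?rnorm_ge0.
- by exists [::]; rewrite /kcomb !big_nil -(scale0r 0) dotZl mul0r.
- exists (kweight (fun=> a) s ++ t); rewrite kcomb_lin /ku kweight_cat kweightC.
  by rewrite kcomb_lin dotDl dotZl.
- apply: le_trans (cauchy_schwarz dotE _ _) _.
  rewrite rmorphM/= -rnormE mulrAC ler_wpM2r//; exact: bnd.
exists g; apply/funext => w.
have /(congr1 Num.conj) : inner H (kvec H w) g = Num.conj (u w) * inner H (kvec H w) f.
  apply: gG; exists [:: (1, w)]; rewrite kcomb1 /ku /kweight /=; split=> //.
  by rewrite /kcomb big_seq1 mulr1 dotZl.
by rewrite !inner_kvecl rmorphM/= !conjCK.
Qed.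

(** Positivity of this kernel is the square of the bound in [multiplierP], with constant
    [Num.sqrt c]. *)
Lemma psd_multiplier u (c : R) : 0 <= c ->
  (forall s, 0 <= \sum_(p <- s) \sum_(q <- s) p.1 * Num.conj q.1 *
     ((c%:C - u q.2 * Num.conj (u p.2)) * k q.2 p.2)) ->
  multiplier H u.
Proof.
move=> c0 psd; apply: (@multiplierP u (Num.sqrt c)); first exact: sqrtr_ge0.
move=> s; rewrite -(@ler_pXn2r _ 2) ?nnegrE ?mulr_ge0 ?ler0c ?sqrtr_ge0//.
rewrite exprMn -!dotE -rmorphXn/= sqr_sqrtr// !inner_kcomb2 -subr_ge0.
have := psd s; rewrite /kweight big_map mulr_sumr -sumrB.
congr (0 <= _); apply: eq_bigr => p _ /=.
rewrite big_map mulr_sumr -sumrB; apply: eq_bigr => q _ /=.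
by rewrite rmorphM/= conjCK; ring.
Qed.

(** Density of the span of the kernel vectors, in dual form: the values of the Riesz vector of [F]
    are the conjugates of the values of [F] on kernel vectors. *)
Lemma functional_kvec_eq0 (F : H -> R[i]) (M : R) : 0 <= M ->
  (forall a f g, F (a *: f + g) = a * F f + F g) ->
  (forall f, `|F f| <= M%:C * `|f|) ->
  (forall w, F (kvec H w) = 0) -> forall f, F f = 0.
Proof.
move=> M0 Flin FM Fk f.
have F0 : F 0 = 0 by have := Flin (-1) 0 0; rewrite scaler0 addr0 mulN1r addNr.
pose G v d := d = F v.
have [|a v c w d ->->|v c ->|g [gG _]] := @riesz_graph _ _ (inner H) dotE G M M0.
- by rewrite /G F0.
- by rewrite /G Flin.
- exact: FM.
have g0 : g = 0.
  apply: evP => w; rewrite ev0 -[LHS]conjCK -inner_kvecl.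
  by rewrite (gG _ (F (kvec H w)))// Fk conjC0.
by rewrite -(gG f _ erefl) g0 -(scale0r 0) dotZr conjC0 mul0r.
Qed.

Section Multiplication.
Variable u : X -> R[i].
Hypothesis um : multiplier H u.

Lemma ev_mult_op f x : ev (mult_op H u f) x = u x * ev f x.
Proof.
have : ev (mult_op H u f) = (fun x => u x * ev f x) := xgetPex 0 (um f).
by move=> ->.
Qed.

Lemma eq_mult_op (T : H -> H) :
  (forall f x, ev (T f) x = u x * ev f x) -> T = mult_op H u.
Proof.
by move=> TE; apply/funext => f; apply: evP => x; rewrite TE ev_mult_op.
Qed.

Lemma mult_op_linear : linear (mult_op H u).
Proof.
move=> a f g; apply: evP => x.
by rewrite ev_linear !ev_mult_op ev_linear; ring.
Qed.

(** The functionals <kcomb s, u f> / |kcomb s| of [f] are continuous, since the adjoint moves [u]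
    onto [kcomb s], and are bounded pointwise by |u f|. Uniform boundedness gives [M], and Riesz
    then bounds |u f| by |M| |f|. *)
Lemma mult_op_bounded : bounded_op (mult_op H u).
Proof.
split; first exact: mult_op_linear.
pose ku := kweight (Num.conj \o u).
have adj f s : inner H (kcomb s) (mult_op H u f) = inner H (kcomb (ku s)) f.
  rewrite !inner_kcomb /ku /kweight big_map; apply: eq_bigr => p _ /=.
  by rewrite ev_mult_op rmorphM/=; ring.
(* When [kcomb s] vanishes, division by zero makes this 0. *)
pose P s f : R := complex.Re `|inner H (kcomb s) (mult_op H u f)| / rnorm (kcomb s).
have PE s f : (P s f)%:C =
    `|inner H (kcomb s) (mult_op H u f)| / (rnorm (kcomb s))%:C.
  by rewrite /P rmorphM/= fmorphV/= RRe_real ?normr_real.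
have V0 s : 0 <= ((rnorm (kcomb s))%:C)^-1 by rewrite invr_ge0 ler0c rnorm_ge0.
have [||s|f|M MP] := @uniform_boundedness R H _ P.
- move=> s f g; rewrite -lecR rmorphD/= !PE -mulrDl ler_wpM2r//.
  by rewrite !adj dotDr ler_normD.
- move=> s r f; apply: complexI; rewrite [RHS]rmorphM/= !PE !adj dotZr normrM.
  by rewrite [Num.conj _]conjc_real normc_def /= expr0n addr0 sqrtr_sqr mulrA.
- exists (rnorm (kcomb (ku s)) / rnorm (kcomb s)) => f.
  rewrite -lecR PE !rmorphM/= fmorphV/= mulrAC ler_wpM2r// adj -!rnormE.
  exact: cauchy_schwarz.
- exists (rnorm (mult_op H u f)) => s.
  rewrite -lecR PE.
  have [->|s0] := eqVneq (rnorm (kcomb s)) 0.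
    by rewrite rmorph0 invr0 mulr0 ler0c rnorm_ge0.
  have s1 : 0 < rnorm (kcomb s) by rewrite lt_def s0 rnorm_ge0.
  rewrite ler_pdivrMr ?ltcR//.
  by rewrite -!rnormE mulrC cauchy_schwarz.
exists `|M| => f.
set Mf := mult_op H u f.
pose G v d := exists s, v = kcomb s /\ d = inner H (kcomb s) Mf.
have [||a v c w d [s [-> ->]] [t [-> ->]]|v d [s [-> ->]]|g [gG gM]] :=
    @riesz_graph _ _ (inner H) dotE G (`|M| * rnorm f).
- by rewrite mulr_ge0 ?rnorm_ge0.
- by exists [::]; rewrite /kcomb !big_nil -(scale0r 0) dotZl mul0r.
- by exists (kweight (fun=> a) s ++ t); rewrite kcomb_lin dotDl dotZl.
- have [s0|s0] := eqVneq (rnorm (kcomb s)) 0.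
    move/eqP : s0; rewrite rnorm_eq0 => /eqP ->.
    by rewrite -(scale0r 0) dotZl mul0r normr0 scale0r normr0 mulr0.
  have s1 : 0 < rnorm (kcomb s) by rewrite lt_def s0 rnorm_ge0.
  rewrite (rnormE (kcomb s)) -ler_pdivrMr ?ltcR// -PE lecR; apply: le_trans (MP _ _) _.
  by rewrite ler_wpM2r ?rnorm_ge0// ler_norm.
have -> : Mf = g.
  apply: evP => w; rewrite -[LHS]conjCK -[RHS]conjCK -!inner_kvecl.
  by rewrite (gG (kvec H w) (inner H (kvec H w) Mf))//; exists [:: (1, w)]; rewrite kcomb1.
by rewrite !rnormE -rmorphM/= lecR.
Qed.

End Multiplication.

End ReproducingKernel.

(** * Positive kernels as limits of finite Gram kernels *)


Lemma cvg_seq_sum (K : numFieldType) (I : Type) (r : seq I) (F : I -> nat -> K)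
    (l : I -> K) : (forall i, F i N @[N --> \oo] --> l i) ->
  \sum_(i <- r) F i N @[N --> \oo] --> \sum_(i <- r) l i.
Proof.
move=> Fl; elim: r => [|i r IH].
  by rewrite big_nil; under eq_fun do rewrite big_nil; exact: cvg_cst.
rewrite big_cons; under eq_fun do rewrite big_cons.
by apply: cvgD => //; exact: Fl.
Qed.

Section GramKernels.
Variables (R : realType) (X : Type).
Implicit Types (K L : X -> X -> R[i]) (f : X -> R[i]) (s : seq (R[i] * X)).

(** Chosen over positive semi-definiteness because closure under products is immediate in this
    form. *)
Definition gram K := exists fs : seq (X -> R[i]),
  forall z w, K z w = \sum_(f <- fs) f z * Num.conj (f w).

Lemma eq_gram K L : (forall z w, K z w = L z w) -> gram L -> gram K.
Proof. by move=> KL [fs fsE]; exists fs => z w; rewrite KL. Qed.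

Lemma gram_rank1 f : gram (fun z w => f z * Num.conj (f w)).
Proof. by exists [:: f] => z w; rewrite big_seq1. Qed.

Lemma gram_cst (c : R[i]) : 0 <= c -> gram (fun _ _ => c).
Proof.
move=> c0; apply: eq_gram (gram_rank1 (fun=> sqrtC c)) => z w.
by rewrite -normCK ger0_norm ?sqrtC_ge0// sqrtCK.
Qed.

Lemma gramD K L : gram K -> gram L -> gram (fun z w => K z w + L z w).
Proof. by move=> [s sE] [t tE]; exists (s ++ t) => z w; rewrite big_cat sE tE. Qed.

Lemma gramM K L : gram K -> gram L -> gram (fun z w => K z w * L z w).
Proof.
move=> [s sE] [t tE]; exists [seq (fun x => f x * g x) | f <- s, g <- t] => z w.
rewrite big_allpairs_dep sE tE mulr_suml; apply: eq_bigr => f _.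
rewrite mulr_sumr; apply: eq_bigr => g _.
by rewrite rmorphM/= mulrACA.
Qed.

Lemma gram_sum (I : Type) (r : seq I) (F : I -> X -> X -> R[i]) :
  (forall i, gram (F i)) -> gram (fun z w => \sum_(i <- r) F i z w).
Proof.
move=> gF; elim: r => [|i r IH].
  by apply: eq_gram (gram_cst (lexx 0)) => z w; rewrite big_nil.
by apply: eq_gram (gramD (gF i) IH) => z w; rewrite big_cons.
Qed.

Lemma gram_prod (I : Type) (r : seq I) (F : I -> X -> X -> R[i]) :
  (forall i, gram (F i)) -> gram (fun z w => \prod_(i <- r) F i z w).
Proof.
move=> gF; elim: r => [|i r IH].
  by apply: eq_gram (gram_cst ler01) => z w; rewrite big_nil.
by apply: eq_gram (gramM (gF i) IH) => z w; rewrite big_cons.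
Qed.

Lemma gramX K n : gram K -> gram (fun z w => K z w ^+ n).
Proof.
move=> gK; apply: eq_gram (gram_prod (iota 0 n) (fun=> gK)) => z w.
by rewrite big_const_seq count_predT size_iota iter_mulr_1.
Qed.

Lemma gram_psd K s : gram K ->
  0 <= \sum_(p <- s) \sum_(q <- s) p.1 * Num.conj q.1 * K q.2 p.2.
Proof.
move=> [fs KE].
have -> : \sum_(p <- s) \sum_(q <- s) p.1 * Num.conj q.1 * K q.2 p.2 =
  \sum_(f <- fs) `|\sum_(p <- s) p.1 * Num.conj (f p.2)| ^+ 2.
  under [RHS]eq_bigr do rewrite normCK rmorph_sum/= mulr_suml.
  rewrite [RHS]exchange_big/=; apply: eq_bigr => p _.
  under [RHS]eq_bigr do rewrite mulr_sumr.
  rewrite [RHS]exchange_big/=; apply: eq_bigr => q _.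
  rewrite KE mulr_sumr; apply: eq_bigr => f _.
  by rewrite rmorphM/= conjCK; ring.
by apply: sumr_ge0 => f _; rewrite exprn_ge0.
Qed.

(** Summing 2 |f(z)| |f(w)| <= |f(z)|^2 + |f(w)|^2 over the Gram functions carries a bound from the
    diagonal to all pairs. *)
Lemma gram_norm_lt K (c : R[i]) z w :
  gram K -> K z z < c -> K w w < c -> `|K z w| < c.
Proof.
move=> [fs KE] zc wc.
have le2 : `|K z w| + `|K z w| <= K z z + K w w.
  rewrite !KE -!big_split/=.
  apply: le_trans (lerD (ler_norm_sum _ _ _) (ler_norm_sum _ _ _)) _.
  rewrite -big_split/=; apply: ler_sum => f _.
  rewrite -!normCK normrM norm_conjC -subr_ge0.
  rewrite (_ : _ - _ = (`|f z| - `|f w|) ^+ 2); last by ring.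
  by rewrite -realEsqr rpredB ?normr_real.
rewrite -(ltr_pMn2r (n := 2))// !mulr2n.
by apply: le_lt_trans le2 _; rewrite ltrD.
Qed.

(** Pointwise limits admit the geometric series of 1/(1 - p_j) and preserve both products and
    positivity. *)
Definition gram_limit K := exists K_ : nat -> X -> X -> R[i],
  (forall N, gram (K_ N)) /\
  forall z w, K_ N z w @[N --> \oo] --> (K z w : R[i]).

Lemma eq_gram_limit K L :
  (forall z w, K z w = L z w) -> gram_limit L -> gram_limit K.
Proof. by move=> KL; have -> : K = L by apply/funext => z; apply/funext. Qed.

Lemma gram_limit_gram K : gram K -> gram_limit K.
Proof. by move=> gK; exists (fun=> K); split=> // z w; exact: cvg_cst. Qed.

Lemma gram_limitD K L :
  gram_limit K -> gram_limit L -> gram_limit (fun z w => K z w + L z w).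
Proof.
move=> [K_ [gK KK]] [L_ [gL LL]]; exists (fun N z w => K_ N z w + L_ N z w).
by split=> [N|z w]; [exact: gramD|exact: cvgD].
Qed.

Lemma gram_limitM K L :
  gram_limit K -> gram_limit L -> gram_limit (fun z w => K z w * L z w).
Proof.
move=> [K_ [gK KK]] [L_ [gL LL]]; exists (fun N z w => K_ N z w * L_ N z w).
by split=> [N|z w]; [exact: gramM|exact: cvgM].
Qed.

Lemma gram_limit_prod (I : Type) (r : seq I) (F : I -> X -> X -> R[i]) :
  (forall i, gram_limit (F i)) ->
  gram_limit (fun z w => \prod_(i <- r) F i z w).
Proof.
move=> gF; elim: r => [|i r IH].
  by apply: eq_gram_limit (gram_limit_gram (gram_cst ler01)) => z w; rewrite big_nil.
by apply: eq_gram_limit (gram_limitM (gF i) IH) => z w; rewrite big_cons.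
Qed.

Lemma gram_limitX K n : gram_limit K -> gram_limit (fun z w => K z w ^+ n).
Proof.
move=> gK; apply: eq_gram_limit (gram_limit_prod (iota 0 n) (fun=> gK)) => z w.
by rewrite big_const_seq count_predT size_iota iter_mulr_1.
Qed.

Lemma gram_limit_psd K s : gram_limit K ->
  0 <= \sum_(p <- s) \sum_(q <- s) p.1 * Num.conj q.1 * K q.2 p.2.
Proof.
move=> [K_ [gK KK]].
pose Q K := \sum_(p <- s) \sum_(q <- s) p.1 * Num.conj q.1 * K q.2 p.2.
have QQ : Q (K_ N) @[N --> \oo] --> Q K.
  apply: cvg_seq_sum => p; apply: cvg_seq_sum => q.
  by apply: cvgM; [exact: cvg_cst|exact: KK].
(* Nonnegativity passes to the limit as the equation |Q| = Q, by uniqueness of limits. *)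
rewrite -/(Q K); suff <- : `|Q K| = Q K by [].
have nQQ : `|Q (K_ N)| @[N --> \oo] --> `|Q K| by exact: cvg_norm QQ.
have nQ : (fun N => `|Q (K_ N)|) = (fun N => Q (K_ N)).
  by apply/funext => N; rewrite ger0_norm// gram_psd.
rewrite nQ in nQQ.
apply: cvg_unique nQQ QQ; exact: norm_hausdorff.
Qed.

Lemma cvg_expr_complex (x : R[i]) : `|x| < 1 -> x ^+ N @[N --> \oo] --> (0 : R[i]).
Proof.
move=> x1; apply/cvgrPdist_lt => e e0.
have e1 : e = (complex.Re e)%:C by rewrite RRe_real ?gtr0_real.
rewrite e1 in e0 *; rewrite ltcR in e0.
have rE : `|x| = (complex.Re `|x|)%:C by rewrite RRe_real ?normr_real.
set r := complex.Re `|x| in rE.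
have r0 : 0 <= r by rewrite -ler0c -rE.
have r1 : `|r| < 1 by rewrite ger0_norm// -ltcR -rE.
have /cvgrPdist_lt/(_ _ e0) := cvg_expr r1.
apply: filterS => N; rewrite !sub0r !normrN normrX ger0_norm ?exprn_ge0//.
by rewrite normrX rE -rmorphXn/= ltcR.
Qed.

Lemma gram_limit_geometric K : gram K -> (forall z w, `|K z w| < 1) ->
  gram_limit (fun z w => (1 - K z w)^-1).
Proof.
move=> gK K1; exists (fun N z w => \sum_(i <- iota 0 N) K z w ^+ i); split=> [N|z w].
  by apply: gram_sum => i; exact: gramX.
have K0 : 1 - K z w != 0.
  by rewrite subr_eq0; apply/eqP => K0; move: (K1 z w); rewrite -K0 normr1 ltxx.
have -> : (fun N => \sum_(i <- iota 0 N) K z w ^+ i) =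
    (fun N => (1 - K z w ^+ N) * (1 - K z w)^-1).
  apply/funext => N; apply: (mulIf K0); rewrite divfK// mulrC.
  have -> : 1 - K z w ^+ N = 1 ^+ N - K z w ^+ N by rewrite expr1n.
  rewrite subrXX; congr (_ * _).
  rewrite -{1}(subn0 N) big_mkord.
  by apply: eq_bigr => i _; rewrite expr1n mul1r.
rewrite -[X in _ --> X]mul1r; apply: cvgM; last exact: cvg_cst.
rewrite -[X in _ --> X]subr0; apply: cvgB; first exact: cvg_cst.
exact: cvg_expr_complex.
Qed.

End GramKernels.


(** * Operators commuting with multipliers *)

Section CommutingMultipliers.
Variables (R : realType) (X : Type) (k : X -> X -> R[i]) (H : rkhs k).
Implicit Types (f g : H) (u v : X -> R[i]).

Lemma multiplier_cst (c : R[i]) : multiplier H (fun=> c).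
Proof. by move=> f; exists (c *: f); apply/funext => x; rewrite evZ. Qed.

Lemma multiplierD u v : multiplier H u -> multiplier H v ->
  multiplier H (fun x => u x + v x).
Proof.
move=> um vm f; have [g gE] := um f; have [h hE] := vm f.
by exists (g + h); apply/funext => x; rewrite evD gE hE mulrDl.
Qed.

Lemma multiplierM u v : multiplier H u -> multiplier H v ->
  multiplier H (fun x => u x * v x).
Proof.
move=> um vm f; have [g gE] := vm f; have [h hE] := um g.
by exists h; apply/funext => x; rewrite hE gE mulrA.
Qed.

Lemma eq_multiplier u v :
  (forall x, u x = v x) -> multiplier H v -> multiplier H u.
Proof. by move=> /funext ->. Qed.

Lemma multiplier_algebra_subalgebra : subalgebra (multiplier_algebra H).
Proof.
split.
- by move=> _ [u um <-]; exact: mult_op_bounded.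
- exists (fun=> 0); first exact: multiplier_cst.
  apply/esym/eq_mult_op; first exact: multiplier_cst.
  by move=> f x; rewrite ev0 mul0r.
- move=> a _ _ [u um <-] [v vm <-].
  have am : multiplier H (fun x => a * u x + v x).
    by apply: multiplierD => //; apply: multiplierM => //; exact: multiplier_cst.
  exists (fun x => a * u x + v x) => //; apply/esym/eq_mult_op => // f x.
  by rewrite ev_linear !ev_mult_op// mulrDl mulrA.
move=> _ _ [u um <-] [v vm <-].
exists (fun x => u x * v x); first exact: multiplierM.
apply/esym/eq_mult_op; first exact: multiplierM.
by move=> f x; rewrite /= !ev_mult_op// mulrA.
Qed.

Lemma multiplier_algebra_abelian : abelian_ops (multiplier_algebra H).
Proof.
move=> _ _ [u um <-] [v vm <-]; apply/funext => f; apply: evP => x.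
by rewrite /= !ev_mult_op// mulrCA.
Qed.

Lemma ev_le f x : `|ev f x| <= (rnorm (kvec H x))%:C * `|f|.
Proof.
rewrite reproducing -rnormE [X in _ <= X]mulrC.
exact: cauchy_schwarz (@inner_norm _ _ _ H) _ _.
Qed.

Variable T : H -> H.
Hypothesis bT : bounded_op T.

(** Commutation of [T] with multiplication by [u], stated through any [g] representing the product,
    so that the choice made in [mult_op] does not enter. *)
Definition intertwines u := multiplier H u /\
  forall f g, ev g = (fun x => u x * ev f x) ->
    forall x, ev (T g) x = u x * ev (T f) x.

Lemma bounded_opD f g : T (f + g) = T f + T g.
Proof. by have [lT _] := bT; have := lT 1 f g; rewrite !scale1r. Qed.

Lemma bounded_op0 : T 0 = 0.
Proof. by apply: (addrI (T 0)); rewrite -bounded_opD !addr0. Qed.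

Lemma bounded_opZ a f : T (a *: f) = a *: T f.
Proof. by have [lT _] := bT; have := lT a f 0; rewrite bounded_op0 !addr0. Qed.

Lemma eq_intertwines u v :
  (forall x, u x = v x) -> intertwines v -> intertwines u.
Proof. by move=> /funext ->. Qed.

Lemma intertwines_cst (c : R[i]) : intertwines (fun=> c).
Proof.
split; first exact: multiplier_cst.
move=> f g gE x; have -> : g = c *: f by apply: evP => y; rewrite gE evZ.
by rewrite bounded_opZ evZ.
Qed.

Lemma intertwinesD u v : intertwines u -> intertwines v ->
  intertwines (fun x => u x + v x).
Proof.
move=> [um uT] [vm vT]; split; first exact: multiplierD.
move=> f g gE x; have [g1 g1E] := um f; have [g2 g2E] := vm f.
have -> : g = g1 + g2 by apply: evP => y; rewrite evD g1E g2E gE mulrDl.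
by rewrite bounded_opD evD (uT _ _ g1E) (vT _ _ g2E) mulrDl.
Qed.

Lemma intertwinesM u v : intertwines u -> intertwines v ->
  intertwines (fun x => u x * v x).
Proof.
move=> [um uT] [vm vT]; split; first exact: multiplierM.
move=> f g gE x; have [h hE] := vm f.
have gh : ev g = (fun x => u x * ev h x).
  by rewrite gE; apply/funext => y; rewrite hE mulrA.
by rewrite (uT _ _ gh) (vT _ _ hE) mulrA.
Qed.

Lemma intertwines_sum (I : Type) (r : seq I) (F : I -> X -> R[i]) :
  (forall i, intertwines (F i)) -> intertwines (fun x => \sum_(i <- r) F i x).
Proof.
move=> gF; elim: r => [|i r IH].
  by apply: eq_intertwines (intertwines_cst 0) => x; rewrite big_nil.
by apply: eq_intertwines (intertwinesD (gF i) IH) => x; rewrite big_cons.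
Qed.

Lemma intertwines_prod (I : Type) (r : seq I) (F : I -> X -> R[i]) :
  (forall i, intertwines (F i)) -> intertwines (fun x => \prod_(i <- r) F i x).
Proof.
move=> gF; elim: r => [|i r IH].
  by apply: eq_intertwines (intertwines_cst 1) => x; rewrite big_nil.
by apply: eq_intertwines (intertwinesM (gF i) IH) => x; rewrite big_cons.
Qed.

Lemma intertwinesX u j : intertwines u -> intertwines (fun x => u x ^+ j).
Proof.
move=> gu; apply: eq_intertwines (intertwines_prod (iota 0 j) (fun=> gu)) => x.
by rewrite big_const_seq count_predT size_iota iter_mulr_1.
Qed.

(* Kernel vectors span a dense subspace, so it suffices to compare on them. *)
Lemma mult_op_of_kvec u :
  (forall z w, ev (T (kvec H w)) z = u z * k z w) ->
  multiplier H u /\ T = mult_op H u.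
Proof.
move=> Tk; have [lT [M MT]] := bT.
have TE f x : ev (T f) x = u x * ev f x.
  apply/eqP; rewrite -subr_eq0; apply/eqP.
  pose F f := ev (T f) x - u x * ev f x; rewrite -/(F f).
  pose r := rnorm (kvec H x).
  have r0 : 0 <= r by exact: rnorm_ge0.
  (* Evaluation at [x] has norm at most [r], which bounds the two terms of [F] separately. The bound
     [M] of [T] comes without a sign, hence its absolute value. *)
  apply: (@functional_kvec_eq0 _ _ _ H F (r * `|M| + complex.Re `|u x| * r)).
  - rewrite addr_ge0 ?mulr_ge0 ?rnorm_ge0//.
    by rewrite -ler0c RRe_real ?normr_real.
  - by move=> a g h; rewrite /F lT !ev_linear; ring.
  - move=> g; apply: le_trans (ler_normB _ _) _.
    rewrite rmorphD/= mulrDl normrM; apply: lerD.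
      apply: le_trans (ev_le _ _) _; rewrite rmorphM/= -mulrA ler_wpM2l ?ler0c//.
      by apply: le_trans (MT g) _; rewrite ler_wpM2r// lecR ler_norm.
    rewrite rmorphM/= RRe_real ?normr_real// -mulrA ler_wpM2l//.
    by apply: le_trans (ev_le _ _) _; rewrite -rnormE.
  - by move=> w; rewrite /F Tk kvecE subrr.
have um : multiplier H u by move=> f; exists (T f); apply/funext => x; exact: TE.
by split=> //; apply: eq_mult_op.
Qed.

End CommutingMultipliers.

(** * The operator norm and pointwise bounds on multipliers *)

Section OperatorNorm.
Variables (R : realType) (V : completeNormedModType R[i]).

Lemma opnormP (T : V -> V) : bounded_op T ->
  0 <= opnorm T /\ forall f, `|T f| <= (opnorm T)%:C * `|f|.
Proof.
move=> [lT [M MT]].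
have T0 : T 0 = 0.
  by have := lT (-1) 0 0; rewrite scaler0 addr0 scaleN1r addNr.
set E := [set complex.Re `|T f| | f in [set f : V | `|f| <= 1]].
have E0 : E 0 by exists 0; rewrite /= ?T0 ?normr0.
have hE : has_sup E.
  split; first by exists 0.
  exists `|M| => _ [f /= f1 <-]; rewrite -lecR RRe_real ?normr_real//.
  apply: le_trans (MT f) _; apply: le_trans (_ : `|M|%:C * `|f| <= _).
    by rewrite ler_wpM2r// lecR ler_norm.
  by rewrite -[X in _ <= X]mulr1 ler_wpM2l// ler0c.
have o0 : 0 <= opnorm T by apply: sup_upper_bound.
split=> // f; have [->|f0] := eqVneq f 0; first by rewrite T0 normr0 mulr0.
have nf0 : 0 < `|f| by rewrite normr_gt0.
have -> : T f = `|f| *: T (`|f|^-1 *: f).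
  have := lT `|f|^-1 f 0; rewrite T0 !addr0 => ->.
  by rewrite scalerA divff ?gt_eqF// scale1r.
rewrite normrZ normr_id mulrC ler_wpM2r//.
rewrite -[`|_|]RRe_real ?normr_real// lecR; apply: sup_upper_bound => //.
exists (`|f|^-1 *: f) => //=.
by rewrite normrZ normfV normr_id mulVf ?gt_eqF.
Qed.

End OperatorNorm.

Section ReproducingMultiplierNorm.
Variables (R : realType) (X : Type) (k : X -> X -> R[i]) (H : rkhs k).

(** Multiplying the kernel vector at [x] by [u] and evaluating at [x] gives [u x * k x x], where
    [k x x] is the squared norm of that vector; evaluation costs one such norm and the operator the
    other. *)
Lemma multiplier_le_opnorm (u : X -> R[i]) (x : X) : multiplier H u ->
  k x x != 0 -> `|u x| <= (opnorm (mult_op H u))%:C.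
Proof.
move=> um kx0; have bT := mult_op_bounded um.
have [oo0 oP] := opnormP bT.
have kE : k x x = `|kvec H x| ^+ 2 by rewrite -(inner_kvec H) inner_norm.
have k0 : 0 < `|kvec H x|.
  by rewrite normr_gt0; apply: contraNneq kx0 => kv0; rewrite kE kv0 normr0 expr0n.
rewrite -(ler_pM2r (exprn_gt0 2 k0)).
rewrite -{1}[_ ^+ 2]ger0_norm ?exprn_ge0// -kE -normrM -{1}(kvecE H) -ev_mult_op//.
apply: le_trans (ev_le _ _) _; rewrite -rnormE kE expr2 mulrA mulrC ler_wpM2r//.
Qed.

End ReproducingMultiplierNorm.

(** * The kernel of the triangle *)


(** Each monomial is a product of rank-one kernels, and its coefficient is nonnegative. *)
Lemma gram_evalp (R : realType) (n : nat) (X : Type) (zeta : X -> 'rV[R[i]]_n)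
    (p : mpoly.mpoly n R[i]) : (forall u, 0 <= mpoly.mcoeff u p) ->
  gram (fun z w => evalp p (diamond (zeta z) (conj_rV (zeta w)))).
Proof.
move=> p0; apply: (@eq_gram _ _ _ (fun z w => \sum_(u <- mpoly.msupp p)
  mpoly.mcoeff u p * \prod_(j <- index_enum 'I_n)
    (zeta z 0 j * Num.conj (zeta w 0 j)) ^+ mpoly.fun_of_multinom u j)).
  move=> z w; rewrite /evalp mpoly.mevalE; apply: eq_bigr => u _.
  by congr (_ * _); apply: eq_bigr => j _; rewrite !mxE.
apply: gram_sum => u; apply: gramM; first exact: gram_cst.
by apply: gram_prod => j; apply: gramX; exact: gram_rank1.
Qed.

Lemma intertwines_evalp (R : realType) (n : nat) (X : Type)
    (k : X -> X -> R[i]) (H : rkhs k) (T : H -> H) (zeta : X -> 'rV[R[i]]_n)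
    (p : mpoly.mpoly n R[i]) (v : 'rV[R[i]]_n) : bounded_op T ->
  (forall j, intertwines T (fun x => zeta x 0 j)) ->
  intertwines T (fun x => evalp p (diamond (zeta x) v)).
Proof.
move=> bT zT; apply: (@eq_intertwines _ _ _ _ _ _ (fun x => \sum_(u <- mpoly.msupp p)
  mpoly.mcoeff u p * \prod_(j <- index_enum 'I_n)
    (zeta x 0 j * v 0 j) ^+ mpoly.fun_of_multinom u j)).
  move=> x; rewrite /evalp mpoly.mevalE; apply: eq_bigr => u _.
  by congr (_ * _); apply: eq_bigr => j _; rewrite !mxE.
apply: intertwines_sum => // u; apply: intertwinesM => //.
  exact: intertwines_cst.
apply: intertwines_prod => // j; apply: intertwinesX => //.
by apply: intertwinesM => //; exact: intertwines_cst.
Qed.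

(** Subtracting the linear term only affects the coefficient of z_j, which becomes 0 because every
    [Q k] is homogeneous of degree at least 2. *)
Lemma positive_regular_remainder (R : realType) (n : nat)
    (P : 'I_n -> mpoly.mpoly n R[i]) (j : 'I_n) : positive_regular P ->
  exists a, 0 < a /\
    forall u, 0 <= mpoly.mcoeff u (P j - a *: mpoly.mpolyX R[i] (mpoly.mnm1 j)).
Proof.
move=> /(_ j)[P0 [a [N [Q [a0 hQ PE]]]]]; exists a; split=> // u.
rewrite mpoly.mcoeffB mpoly.mcoeffZ mpoly.mcoeffX.
have [<-|uj] := eqVneq; last by rewrite mulr0 subr0.
rewrite PE mpoly.mcoeffD mpoly.mcoeffZ mpoly.mcoeffX eqxx mulr1 addrC addKr.
rewrite raddf_sum/= big_seq_cond big1// => k /andP[]; rewrite mem_index_iota => kN _.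
apply: (mpoly.dhomog_nemf_coeff (hQ k kN)) => /=.
by rewrite mpoly.mdeg1; case: k kN => [|[|]].
Qed.

Section Triangle.
Variables (R : realType) (n : nat) (P : 'I_n -> mpoly.mpoly n R[i]).
Hypothesis hP : positive_regular P.
Variables (m : 'I_n -> nat).
Hypothesis hm : forall j, (0 < m j)%N.
Local Notation X := (triangle P).

Definition zeta (z : X) : 'rV[R[i]]_n := phi (set_val z).

Definition pker j (z w : X) : R[i] :=
  evalp (P j) (diamond (zeta z) (conj_rV (zeta w))).

(* The Jacobian determinant of [phi]. *)
Definition jac (z : X) : R[i] := \prod_(j < n | (0 < j)%N) (set_val z 0 j)^-1.

Lemma coord_neq0 (z : X) (j : 'I_n) : (0 < j)%N -> set_val z 0 j != 0.
Proof. by move=> j0; have [h _] := set_valP z; exact: h. Qed.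

Lemma jac_neq0 z : jac z != 0.
Proof. by apply/prodf_neq0 => j j0; rewrite invr_eq0 coord_neq0. Qed.

Lemma gram_pker j : gram (pker j).
Proof. by apply: gram_evalp; have [] := hP j. Qed.

Lemma pker_lt1 j z w : `|pker j z w| < 1.
Proof.
have lt1 x : pker j x x < 1 by have [_ h] := set_valP x; exact: h.
by apply: gram_norm_lt => //; exact: gram_pker.
Qed.

Lemma pker_neq1 j z w : 1 - pker j z w != 0.
Proof.
rewrite subr_eq0; apply/eqP => p1; have := pker_lt1 j z w.
by rewrite -p1 normr1 ltxx.
Qed.

Lemma triangle_kernelE (z w : X) : triangle_kernel m z w =
  jac z * Num.conj (jac w) * \prod_(j < n) (1 - pker j z w)^-1 ^+ m j.
Proof.
rewrite /triangle_kernel /kernelPm /jac rmorph_prod/= -big_split/=; congr (_ * _).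
  by apply: eq_bigr => j _; rewrite fmorphV/= invfM.
by apply: eq_bigr => j _; rewrite exprVn.
Qed.

Lemma triangle_kernel_neq0 (z w : X) : triangle_kernel m z w != 0.
Proof.
rewrite triangle_kernelE !mulf_neq0 ?conjC_eq0 ?jac_neq0//.
by apply/prodf_neq0 => j _; rewrite expf_neq0// invr_eq0 pker_neq1.
Qed.

(* With [q := p_i - a zeta_i conj(omega_i)], which has nonnegative coefficients,
   [(1 - a zeta_i conj(omega_i)) / (1 - p_i) = 1 + q / (1 - p_i)]. *)
Lemma gram_limit_zeta i : exists2 c : R, 0 <= c &
  gram_limit (fun z w : X =>
    (c%:C - zeta z 0 i * Num.conj (zeta w 0 i)) * triangle_kernel m z w).
Proof.
have [a [a0 aP]] := positive_regular_remainder i hP.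
have a1 : a^-1 = (complex.Re a^-1)%:C by rewrite RRe_real// gtr0_real ?invr_gt0.
exists (complex.Re a^-1); first by rewrite -ler0c -a1 invr_ge0 ltW.
rewrite -a1.
have := gram_evalp zeta aP; set q := (fun z w => evalp _ _) => gq.
have qE z w : q z w = pker i z w - a * (zeta z 0 i * Num.conj (zeta w 0 i)).
  by rewrite /q /pker /evalp mpoly.mevalB mpoly.mevalZ mpoly.mevalXU !mxE.
pose g j z w := (1 - pker j z w)^-1.
have gg j : gram_limit (g j).
  by apply: gram_limit_geometric; [exact: gram_pker|exact: pker_lt1].
(* The exponent drops by one at [i]: that factor 1/(1 - p_i), available since [m i] is positive, is
   absorbed by the first bracket. *)
apply: (@eq_gram_limit _ _ _ (fun z w => a^-1 * (1 + q z w * g i z w) *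
   (jac z * Num.conj (jac w) * \prod_(j <- index_enum 'I_n) g j z w ^+ (m j - (j == i))))).
  move=> z w; rewrite triangle_kernelE.
  rewrite (bigD1 i)//= [X in _ = _ * (_ * X)](bigD1 i)//= eqxx.
  rewrite -{1}(subnK (hm i)) addn1 exprSr -/(g i z w).
  rewrite [X in _ = _ * (_ * (_ * X))](eq_bigr (fun j => g j z w ^+ m j)); last first.
    by move=> j /negPf ->; rewrite subn0.
  rewrite /= -/(g _ z w).
  have := pker_neq1 i z w; rewrite qE /g => p1.
  by field; rewrite p1 gt_eqF.
apply: gram_limitM.
  apply: gram_limitM; first by apply/gram_limit_gram/gram_cst; rewrite invr_ge0 ltW.
  apply: gram_limitD; first by apply/gram_limit_gram/gram_cst; exact: ler01.
  by apply: gram_limitM => //; exact: gram_limit_gram.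
apply: gram_limitM; first by apply: gram_limit_gram; exact: gram_rank1.
by apply: gram_limit_prod => j; exact: gram_limitX.
Qed.

Variable H : H2m P m.

Lemma multiplier_zeta i : multiplier H (fun z => zeta z 0 i).
Proof.
have [c c0 gK] := gram_limit_zeta i.
by apply: psd_multiplier c0 _ => s; exact: gram_limit_psd gK.
Qed.

Lemma zetaE (z : X) i : zeta z 0 i =
  if (i.+1 < n)%N then set_val z 0 i / set_val z 0 (ordS i) else set_val z 0 i.
Proof. by rewrite /zeta /phi mxE. Qed.

Lemma coord_ordS (z : X) (i : 'I_n) : (i.+1 < n)%N -> set_val z 0 (ordS i) != 0.
Proof. by move=> ilt; apply: coord_neq0; rewrite /= modn_small. Qed.

(** Downward from the last coordinate, which is itself a [zeta]: z_i is the product of zeta_i and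
    z_(i+1). Hence the induction on [n - i]. *)
Lemma multiplier_coord i : multiplier H (@coord_fun R n X i).
Proof.
elim/ltn_ind : {i}(n - i)%N {-2}i (erefl (n - i)%N) => d IH i di.
have [ilt|ige] := ltnP i.+1 n; last first.
  apply: eq_multiplier (multiplier_zeta i) => z.
  by rewrite zetaE ltnNge ige.
have iS : ordS i = i.+1 :> nat by rewrite /= modn_small.
have mS : multiplier H (@coord_fun R n X (ordS i)).
  by apply: (IH (n - ordS i)%N) => //; rewrite iS -di ltn_sub2l// ltnW.
apply: eq_multiplier (multiplierM (multiplier_zeta i) mS) => z.
by rewrite zetaE ilt /coord_fun divfK// coord_ordS.
Qed.

End Triangle.


(** * The commutant *)

Section Commutant.
Variables (R : realType) (n : nat) (P : 'I_n -> mpoly.mpoly n R[i]).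
Hypothesis hP : positive_regular P.
Variables (m : 'I_n -> nat).
Hypothesis hm : forall j, (0 < m j)%N.
Variable H : H2m P m.
Local Notation X := (triangle P).

Lemma commutant_intertwines_coord (T : H -> H) i : commutant_Mz H T ->
  intertwines T (@coord_fun R n X i).
Proof.
move=> [bT cT].
have mi : multiplier H (@coord_fun R n X i) := multiplier_coord hP hm i.
split=> // f g gE z.
have -> : g = mult_op H (@coord_fun R n X i) f.
  by apply: evP => x; rewrite gE ev_mult_op.
have /= -> := congr1 (fun S => S f) (cT i).
by rewrite ev_mult_op.
Qed.

(* Since [z_(i+1)] does not vanish, [z_(i+1) zeta_i = z_i] lets us divide. *)
Lemma commutant_intertwines_zeta (T : H -> H) i : commutant_Mz H T ->
  intertwines T (fun z : X => zeta z 0 i).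
Proof.
move=> cT; split; first exact: multiplier_zeta.
move=> f g gE z; have [mi ci] := commutant_intertwines_coord i cT.
have [ilt|ige] := ltnP i.+1 n; last first.
  have zE (x : X) : zeta x 0 i = @coord_fun R n X i x.
    by rewrite zetaE ltnNge ige.
  by rewrite zE; apply: ci; rewrite gE; apply/funext => x; rewrite zE.
have [_ cS] := commutant_intertwines_coord (ordS i) cT.
(* The element [h] represents both z_i f and z_(i+1) g; comparing the two readings of [T h] gives
   the claim after cancelling z_(i+1). *)
have [h hE] := mi f.
have hgE : ev h = (fun x => @coord_fun R n X (ordS i) x * ev g x).
  rewrite hE gE; apply/funext => x; rewrite zetaE ilt /coord_fun.
  by rewrite mulrA [_ * (_ / _)]mulrC divfK// coord_ordS.
apply: (mulfI (coord_ordS z ilt)).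
rewrite -[LHS](cS _ _ hgE) (ci _ _ hE) zetaE ilt /coord_fun mulrA.
by rewrite [_ * (_ / _)]mulrC divfK// coord_ordS.
Qed.

(** For fixed [w] the product is a polynomial in the coordinates of [zeta]. *)
Lemma intertwines_denominator (T : H -> H) (w : X) : commutant_Mz H T ->
  intertwines T (fun z : X => \prod_(j <- index_enum 'I_n) (1 - pker j z w) ^+ m j).
Proof.
move=> cT; have [bT _] := cT.
apply: intertwines_prod => // j; apply: intertwinesX => //.
apply: intertwinesD => //; first exact: intertwines_cst.
apply: (@eq_intertwines _ _ _ _ _ _ (fun z => -1 * pker j z w)).
  by move=> z; rewrite mulN1r.
apply: intertwinesM => //; first exact: intertwines_cst.
by apply: intertwines_evalp => // i; exact: commutant_intertwines_zeta.
Qed.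

(* Multiplied by its denominator, the kernel vector at [w] becomes
   [conj (jac w) * jac], which depends on [w] only through a constant. *)
Lemma commutant_kvec (T : H -> H) (z w w0 : X) : commutant_Mz H T ->
  ev (T (kvec H w)) z * ev (kvec H w0) z = ev (T (kvec H w0)) z * ev (kvec H w) z.
Proof.
move=> cT; have [bT _] := cT.
pose q (w z : X) := \prod_(j <- index_enum 'I_n) (1 - pker j z w) ^+ m j.
have q0 v : q v z != 0.
  rewrite /q big_seq_cond; apply/prodf_neq0 => j _.
  by rewrite expf_neq0// pker_neq1.
have qk v x : q v x * ev (kvec H v) x = jac x * Num.conj (jac v).
  rewrite kvecE triangle_kernelE mulrCA -big_split/= big1 ?mulr1// => j _.
  by rewrite -exprMn divff ?expr1n// pker_neq1.
have [mw cw] := intertwines_denominator w cT.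
have [mw0 cw0] := intertwines_denominator w0 cT.
have [g gE] := mw (kvec H w); have [h hE] := mw0 (kvec H w0).
(* Both sides are multiples of [jac] with the same constant. Applying [T], evaluating at [z] and
   cancelling the nonzero denominators gives the claim. *)
have gh : Num.conj (jac w0) *: g = Num.conj (jac w) *: h.
  apply: evP => x; rewrite !evZ gE hE -/(q w x) -/(q w0 x) !qk; ring.
have := congr1 (fun f => ev (T f) z) gh.
rewrite !(bounded_opZ bT) !evZ (cw _ _ gE) (cw0 _ _ hE) -/(q w z) -/(q w0 z).
move=> TE; apply: (mulfI (q0 w)); apply: (mulfI (q0 w0)).
have := qk w z; have := qk w0 z.
set A := ev (T _) z in TE *; set B := ev (T _) z in TE *.
set a := ev _ z; set b := ev _ z => qa qb.
have -> : q w0 z * (q w z * (A * a)) = q w z * A * (q w0 z * a) by ring.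
have -> : q w0 z * (q w z * (B * b)) = q w0 z * B * (q w z * b) by ring.
rewrite qa qb.
have -> : q w z * A * (jac z * Num.conj (jac w0)) =
  jac z * (Num.conj (jac w0) * (q w z * A)) by ring.
rewrite TE; ring.
Qed.

Lemma commutant_mult_op (T : H -> H) (w : X) : commutant_Mz H T ->
  let u z := ev (T (kvec H w)) z / ev (kvec H w) z in
  multiplier H u /\ T = mult_op H u.
Proof.
move=> cT u; have [bT _] := cT; apply: mult_op_of_kvec => // z v.
have k0 : ev (kvec H w) z != 0 by rewrite kvecE triangle_kernel_neq0.
apply: (mulIf k0); rewrite (commutant_kvec z v w cT) /u -(kvecE H).
by rewrite mulrAC divfK.
Qed.

Lemma commutantE : commutant_Mz H = multiplier_algebra H.
Proof.
apply/seteqP; split=> [T cT|_ [u um <-]]; last first.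
  split=> [|i]; first exact: mult_op_bounded.
  apply: multiplier_algebra_abelian; first by exists u.
  by eexists; [exact: multiplier_coord|].
(* The quotient needs a base point. Over an empty domain all elements of [H] coincide, and the zero
   function represents [T]. *)
have [w|noX] := pselect (inhabited X).
  case: w => w; have [um ->] := commutant_mult_op w cT.
  by eexists; [exact: um|].
exists (fun=> 0); first exact: multiplier_cst.
apply/esym/eq_mult_op; first exact: multiplier_cst.
by move=> f x; case: noX; split.
Qed.

(** The coordinate multiplications lie in the commutant, hence in any abelian [B] containing it, so
    every member of [B] commutes with them. *)
Lemma maximal_abelian_commutant : maximal_abelian_subalgebra (commutant_Mz H).
Proof.
rewrite commutantE; split.
- exact: multiplier_algebra_subalgebra.
- exact: multiplier_algebra_abelian.
move=> B [Bb _ _ _] Bab sub; apply/seteqP; split=> // T BT.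
rewrite -commutantE; split=> [|i]; first exact: Bb.
apply: Bab => //; apply: sub.
by eexists; [exact: multiplier_coord|].
Qed.

Lemma holomorphic_div (f g : X -> R[i]) : (forall z, g z != 0) ->
  holomorphic f -> holomorphic g -> holomorphic (fun z => f z / g z).
Proof.
move=> g0 [F [Ff dF]] [G [Gg dG]]; exists (F * (fun z => (G z)^-1)); split.
  by move=> z; rewrite -Ff -Gg.
move=> z Xz; apply: differentiableM; first exact: dF.
apply: differentiableV; first exact: dG.
by have := g0 (SigSub (mem_set Xz)); rewrite -Gg.
Qed.

(** Holomorphy: [u] is the quotient of two elements of [H], its product with a kernel vector and
    that kernel vector, which has no zero. *)
Lemma Hinfty_multiplier (u : X -> R[i]) : multiplier H u ->
  Hinfty u /\ supnorm u <= opnorm (mult_op H u).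
Proof.
move=> um; have [op0 _] := opnormP (mult_op_bounded um).
have ule z : `|u z| <= (opnorm (mult_op H u))%:C.
  by apply: multiplier_le_opnorm => //; exact: triangle_kernel_neq0.
split; last first.
  rewrite /supnorm; have [[z]|noX] := pselect (inhabited X).
    apply: ge_sup; first by exists (complex.Re `|u z|), z.
    by move=> _ [x _ <-]; rewrite -lecR RRe_real ?normr_real.
  (* With no points the supremum is over the empty set and takes its default value 0. *)
  have -> : range (fun z => complex.Re `|u z|) = set0.
    by rewrite -subset0 => y [x _ _]; case: (noX (inhabits x)).
  by rewrite sup0.
split; last by exists (opnorm (mult_op H u)).
have [[w]|noX] := pselect (inhabited X); last first.
  exists (fun=> 0); split=> [z|z Xz]; first by case: (noX (inhabits z)).
  by case: (noX (inhabits (SigSub (mem_set Xz)))).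
have k0 z : ev (kvec H w) z != 0 by rewrite kvecE triangle_kernel_neq0.
have -> : u = (fun z => ev (mult_op H u (kvec H w)) z / ev (kvec H w) z).
  by apply/funext => z; rewrite ev_mult_op// mulfK.
by apply: holomorphic_div => //; exact: H2m_holomorphic.
Qed.

End Commutant.

Theorem theorem6p1 (R : realType) (n : nat) (hn : (2 <= n)%N)
    (P : 'I_n -> mpoly.mpoly n R[i]) (hP : positive_regular P)
    (m : 'I_n -> nat) (hm : forall j, (0 < m j)%N) (H : H2m P m) :
  [/\ maximal_abelian_subalgebra (commutant_Mz H),
      commutant_Mz H = multiplier_algebra H
    & forall (T : H -> H) (f : triangle P -> R[i]),
        commutant_Mz H T -> multiplier H f -> T = mult_op H f ->
        Hinfty f /\ supnorm f <= opnorm T].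
Proof.
split; [exact: maximal_abelian_commutant|exact: commutantE|].
by move=> _ f _ fm ->; exact: Hinfty_multiplier.
Qed.
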